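(* Let $p \ge 1$ and $C_U \ge 1$. There exists a constant $C>0$, depending only on $p$ and $C_U$, such that for every metric space $(X,d_X)$ which satisfies the infrasup $p$-umbel inequality with constant $C_U$ and every $h \in \mathbb{N}$, the minimum distortion necessary for embedding the countably branching tree $([\mathbb{N}]^{\le h}, d_T)$ into $X$ is at least $C(\log_2 h)^{1/p}$; that is, every bi-Lipschitz embedding $f:[\mathbb{N}]^{\le h}\to X$ satisfies $\mathrm{dist}(f)\ge C(\log_2 h)^{1/p}$.
   Context: Infrasup $p$-umbel inequality: an infinite metric space $(X,d)$ satisfies the infrasup $p$-umbel inequality with constant $C_U>0$ if for any infinite collection of points $w,z,x_1,x_2,x_3,\dots\in X$, $$\frac{1}{2^p}\inf_{n\in\mathbb{N}} d(w,x_n)^p+\frac{1}{C_U^p}\inf_{i\ne j\in\mathbb{N}} d(x_i,x_j)^p\le \max\Big\{d(w,z)^p,\ \sup_{n\in\mathbb{N}} d(x_n,z)^p\Big\}.$$ Countably branching tree of height $h$: $[\mathbb{N}]^{\le h}=\{A\subset\mathbb{N} : 0\le |A|\le h\}$. Nonempty elements are written as increasing tuples $\bar n=(n_1,\dots,n_l)$ with $n_1<\dots<n_l$, $1\le l\le h$; the root is the empty set. The metric $d_T$ is the tree metric: if $\bar u=(u_1,\dots,u_s)$ is the longest common initial segment of $\bar m=(\bar u,m_1,\dots,m_k)$ and $\bar n=(\bar u,n_1,\dots,n_l)$, then $d_T(\bar m,\bar n)=k+l$. Distortion: for metric spaces $(Y,d_Y)$, $(X,d_X)$ and a map $f:Y\to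 X$, $\mathrm{dist}(f)$ is the smallest $K\ge 1$ for which there is $\lambda>0$ with $\lambda d_Y(x,y)\le d_X(f(x),f(y))\le K\lambda d_Y(x,y)$ for all $x,y\in Y$; $f$ is bi-Lipschitz if such a $K$ exists. *)

(* Defs.v *)
From HB Require Import structures.
From mathcomp Require Import all_boot all_order all_algebra finmap.
From mathcomp Require Import all_classical all_reals all_analysis.

Set Implicit Arguments.
Unset Strict Implicit.
Unset Printing Implicit Defensive.

Import Order.TTheory GRing.Theory Num.Theory.

Local Open Scope classical_set_scope.
Local Open Scope ring_scope.

(* The points need not be distinct. The supremum may be infinite, so the
   inequality is stated in the extended reals. *)
Definition infrasup_umbel (R : realType) (p CU : R) (X : metricType R) : Prop :=
  infinite_set [set: X] /\
  forall (w z : X) (x : nat -> X),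
    ((1 / 2 `^ p)%:E *
        ereal_inf [set (mdist w (x n) `^ p)%:E | n in [set: nat]] +
      (1 / CU `^ p)%:E *
        ereal_inf [set (mdist (x ij.1) (x ij.2) `^ p)%:E
                  | ij in [set ij : nat * nat | ij.1 != ij.2]]
     <= maxe (mdist w z `^ p)%:E
         (ereal_sup [set (mdist (x n) z `^ p)%:E | n in [set: nat]]))%E.

Definition tree (h : nat) : Type := {A : {fset nat} | (#|` A| <= h)%N}.

Definition increasing_tuple (h : nat) (A : tree h) : seq nat :=
  sort leq (enum_fset (val A)).

Fixpoint common_prefix (s t : seq nat) : seq nat :=
  match s, t with
  | a :: s', b :: t' => if a == b then a :: common_prefix s' t' else [::]
  | _, _ => [::]
  end.

Lemma common_prefix_longest (s t : seq nat) :
  [/\ prefix (common_prefix s t) s, prefix (common_prefix s t) t &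
      forall u, prefix u s -> prefix u t -> prefix u (common_prefix s t)].
Proof.
elim: s t => [|a s IHs] [|b t] //=; try by split => // -[].
have [ps pt longest] := IHs t.
case: eqP => [<-|neq_ab]; split => //=.
- by rewrite eqxx.
- by rewrite eqxx.
- case=> [|c u] //= /andP[ca us] /andP[_ ut].
  by rewrite ca longest.
- by case=> [|c u] //= /andP[/eqP-> _] /andP[/eqP].
Qed.

Definition tree_dist (h : nat) (A B : tree h) : nat :=
  let m := increasing_tuple A in
  let n := increasing_tuple B in
  let u := common_prefix m n in
  ((size m - size u) + (size n - size u))%N.

Section Distortion.
Variables (R : realType) (Y X : Type).
Variables (dY : Y -> Y -> R) (dX : X -> X -> R) (f : Y -> X).

Definition distortion_bound (K : R) : Prop :=
  1 <= K /\
  exists2 lambda : R, 0 < lambda &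
    forall x y, lambda * dY x y <= dX (f x) (f y) <= K * lambda * dY x y.

Definition bi_lipschitz : Prop := exists K, distortion_bound K.

(* For metrics, the infimum is attained when f is bi-Lipschitz; otherwise it
   takes the junk value 0. *)
Definition distortion : R := inf [set K | distortion_bound K].

End Distortion.

Definition log2 (R : realType) (x : R) : R := ln x / ln 2.

(* Main.v *)
Require Import Defs.
From mathcomp Require Import all_boot all_order all_algebra finmap.
From mathcomp Require Import all_classical all_reals all_analysis.
From mathcomp Require Import zify lra.

Import Order.TTheory GRing.Theory Num.Theory.

Local Open Scope ring_scope.

(** The mechanism is a gain of a fixed amount at every doubling of scale.
    Let f satisfy l * dT <= d <= K * l * dT, and write a_k = (l * 2^k)^p.

    By induction on k, from every vertex s and through every child of s one
    can reach a descendant t at tree distance 2^k from s with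
      d (f s, f t)^p <= a_k * (K^p - k / CU^p)       ([short_descendant]).
    For k = 0 this is the upper Lipschitz bound.  For the step, apply the
    hypothesis to s to reach z, and then to z once for each of its infinitely
    many children, reaching x_0, x_1, ...  All the distances d (w, z) and
    d (x_n, z), where w = f s, are bounded by the same quantity, while the x_n
    are pairwise at tree distance 2^(k+1), so that
    d (x_i, x_j)^p >= a_(k+1) = 2^p * a_k.  The umbel inequality then says that
    inf_n d (w, x_n)^p / 2^p is smaller than that bound by at least
    2^p * a_k / CU^p > a_k / CU^p.  Because this is an infimum over n, some x_n
    realises the gain, and x_n lies below the child of s chosen at the start.
    Quantifying existentially over descendants, rather than taking a supremum
    of d over all pairs at distance 2^k, is what makes an infimum on the left
    of the umbel inequality sufficient to iterate.

    At the largest k with 2^k <= h, the lower bound on d gives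
    1 <= K^p - k / CU^p.  Since log2 h <= k + 1 and CU >= 1, this yields
    K^p >= (k + 1) / CU^p >= log2 h / CU^p, so that C = 1 / CU works. *)

(** * Vertices of the tree as increasing sequences *)

Definition root h : tree h := exist _ fset0 (leq0n h).

(** Sequences with too many entries are sent to the root, to avoid carrying
    size proofs inside terms. *)
Definition vertex h (s : seq nat) : tree h := insubd (root h) (seq_fset tt s).

Lemma increasing_tuple_vertex h s :
  sorted ltn s -> (size s <= h)%N -> increasing_tuple (vertex h s) = s.
Proof.
rewrite ltn_sorted_uniq_leq => /andP[s_uniq s_sorted] le_sh.
rewrite /increasing_tuple /vertex val_insubd size_seq_fset undup_id // le_sh.
apply: (sorted_eq leq_trans anti_leq) => //; first exact/sort_sorted/leq_total.
by rewrite perm_sort (permPl (seq_fset_perm tt s)) undup_id.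
Qed.

Lemma common_prefix_cat s t u :
  common_prefix (s ++ t) (s ++ u) = s ++ common_prefix t u.
Proof. by elim: s => //= a s ->; rewrite eqxx. Qed.

Lemma tree_dist_descendant h s u :
  sorted ltn (s ++ u) -> (size (s ++ u) <= h)%N ->
  tree_dist (vertex h s) (vertex h (s ++ u)) = size u.
Proof.
move=> su_incr le_h; have [s_incr _] := cat_sorted2 su_incr.
have le_s : (size s <= h)%N by move: le_h; rewrite size_cat; lia.
rewrite /tree_dist !increasing_tuple_vertex //.
rewrite -[in common_prefix s](cats0 s) common_prefix_cat !cats0 size_cat.
by rewrite subnn add0n addKn.
Qed.

Lemma tree_dist_fork h s a b t u : a != b ->
  sorted ltn (s ++ a :: t) -> sorted ltn (s ++ b :: u) ->
  (size (s ++ a :: t) <= h)%N -> (size (s ++ b :: u) <= h)%N ->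
  tree_dist (vertex h (s ++ a :: t)) (vertex h (s ++ b :: u)) =
  ((size t).+1 + (size u).+1)%N.
Proof.
move=> /negPf neq_ab ta_incr ub_incr le_t le_u.
rewrite /tree_dist !increasing_tuple_vertex // common_prefix_cat /= neq_ab.
by rewrite cats0 !size_cat /= !addKn.
Qed.

(** * The gain at one doubling of scale *)

Section UmbelSpace.
Variables (R : realType) (p CU : R) (X : metricType R).
Hypotheses (hp : 1 <= p) (hCU : 1 <= CU) (umbel : infrasup_umbel p CU X).

Let p_gt0 : 0 < p := lt_le_trans ltr01 hp.
Let CU_gt0 : 0 < CU := lt_le_trans ltr01 hCU.

Lemma umbel_bound (w z : X) (x : nat -> X) (a b M : R) :
  (forall n, a <= mdist w (x n) `^ p) ->
  (forall i j, i != j -> b <= mdist (x i) (x j) `^ p) ->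
  mdist w z `^ p <= M -> (forall n, mdist (x n) z `^ p <= M) ->
  a / 2 `^ p + b / CU `^ p <= M.
Proof.
move=> a_lb b_lb wz_ub xz_ub; have [_ /(_ w z x) umbel_ineq] := umbel.
rewrite -lee_fin EFinD [a / _]mulrC [b / _]mulrC
  -(div1r (2 `^ p)) -(div1r (CU `^ p))
  (EFinM _ a) (EFinM _ b).
have weight_ge0 (c : R) : (0 <= (1 / c `^ p)%:E)%E.
  by rewrite lee_fin div1r invr_ge0 powR_ge0.
apply: le_trans (le_trans _ umbel_ineq) _.
  apply: leeD; apply: lee_wpmul2l => //.
    by apply/ereal_infP => _ [n _ <-]; rewrite lee_fin.
  by apply/ereal_infP => _ [[i j] /= ? <-]; rewrite lee_fin b_lb.
rewrite ge_max lee_fin wz_ub /=.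
by apply/ereal_supP => _ [n _ <-]; rewrite lee_fin.
Qed.

(** The triangle inequality alone gives the conclusion with B in place of
    B - 1 / CU^p.  The separation term of the umbel inequality is worth
    2^p * r^p / CU^p, strictly more than the r^p / CU^p being claimed, and this
    slack is why an infimum over n that need not be attained causes no loss. *)
Lemma umbel_gain (w z : X) (x : nat -> X) (r B : R) : 0 < r ->
  (forall i j, i != j -> 2 * r <= mdist (x i) (x j)) ->
  mdist w z `^ p <= r `^ p * B ->
  (forall n, mdist z (x n) `^ p <= r `^ p * B) ->
  exists n, mdist w (x n) `^ p <= (2 * r) `^ p * (B - 1 / CU `^ p).
Proof.
move=> r_gt0 sep wz_ub zx_ub; apply: contrapT => no_gain.
have CUp_gt0 : 0 < CU `^ p by exact: powR_gt0.
have rp_gt0 : 0 < r `^ p by rewrite powR_gt0.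
have twop_gt1 : 1 < 2 `^ p :> R.
  by apply: lt_le_trans (_ : 1 < 2) _; [lra | apply: le1r_powR => //; lra].
have : (2 * r) `^ p * (B - 1 / CU `^ p) / 2 `^ p + (2 * r) `^ p / CU `^ p
       <= r `^ p * B.
  apply: (@umbel_bound w z x) => //.
  - move=> n; rewrite leNgt; apply/negP => gain_n; apply: no_gain.
    by exists n; apply: ltW.
  - move=> i j neq_ij; apply: ge0_ler_powR; rewrite ?nnegrE ?mdist_ge0 ?sep ?ltW //.
    by rewrite mulr_gt0.
  - by move=> n; rewrite metric_sym.
rewrite (powRM _ (ler0n _ 2) (ltW r_gt0)) !div1r.
have -> : 2 `^ p * r `^ p * (B - (CU `^ p)^-1) / 2 `^ p = r `^ p * (B - (CU `^ p)^-1).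
  by rewrite mulrC -mulrA mulKf ?gt_eqF //; lra.
have inv_gt0 : 0 < (CU `^ p)^-1 by rewrite invr_gt0.
by have := mulr_gt0 rp_gt0 inv_gt0; nra.
Qed.

(** * Iterating over dyadic scales *)

Variables (h : nat) (f : tree h -> X) (K l : R).
Hypotheses (l_gt0 : 0 < l)
  (f_lip : forall A B : tree h,
    l * (tree_dist A B)%:R <= mdist (f A) (f B) <= K * l * (tree_dist A B)%:R).

Let F s := f (vertex h s).

Let incr_child (s : seq nat) m t i : sorted ltn (s ++ m :: t) ->
  sorted ltn (rcons (s ++ m :: t) ((last m t).+1 + i)).
Proof.
rewrite -cats1 -catA cat_cons !sorted_cat_cons => /andP[-> /=].
by rewrite cat_path => -> /=; lia.
Qed.

Lemma short_descendant k s m :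
  sorted ltn (rcons s m) -> (size s + 2 ^ k <= h)%N ->
  exists t, [/\ (size t).+1 = (2 ^ k)%N, sorted ltn (s ++ m :: t) &
    mdist (F s) (F (s ++ m :: t)) `^ p
      <= (l * 2 ^+ k) `^ p * (K `^ p - k%:R / CU `^ p)].
Proof.
elim: k s m => [|k IHk] s m sm_incr le_h.
  (* One edge: the upper Lipschitz bound, with no gain yet. *)
  exists [::]; split=> //; rewrite cats1 //.
  have /andP[lb ub] := f_lip (vertex h s) (vertex h (rcons s m)).
  have dist1 : tree_dist (vertex h s) (vertex h (rcons s m)) = 1%N.
    by rewrite -cats1 tree_dist_descendant ?cats1 ?size_rcons //; lia.
  move: lb ub; rewrite dist1 !mulr1 mul0r subr0 => lb ub.
  have K_ge0 : 0 <= K by rewrite -(pmulr_lge0 _ l_gt0) (le_trans _ ub) ?mdist_ge0.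
  rewrite -powRM ?(ltW l_gt0) // mulrC; apply: ge0_ler_powR; rewrite ?(ltW p_gt0) //.
    by rewrite nnegrE mdist_ge0.
  by rewrite nnegrE mulr_ge0 // ltW.
have le_hk : (size s + 2 ^ k <= h)%N by move: le_h; rewrite expnS; lia.
have [t [t_size z_incr wz_ub]] := IHk s m sm_incr le_hk.
(* Labels of the children of z must exceed the last entry of z, hence the
   shift in c. *)
pose z := s ++ m :: t; pose c i := ((last m t).+1 + i)%N.
have z_size : size z = (size s + 2 ^ k)%N by rewrite size_cat /= t_size.
have le_hz : (size z + 2 ^ k <= h)%N.
  by move: le_h; rewrite z_size expnS; lia.
have /choice[u u_spec] i := IHk z (c i) (incr_child s m t i z_incr) le_hz.
pose y i := z ++ c i :: u i.
have y_size i : (size (y i) <= h)%N.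
  by rewrite size_cat /=; have [-> _ _] := u_spec i.
have [|||n gain] := @umbel_gain (F s) (F z) (F \o y) _ _ _ _ wz_ub.
- by rewrite mulr_gt0 ?exprn_gt0.
- move=> i j neq_ij /=.
  have /andP[+ _] := f_lip (vertex h (y i)) (vertex h (y j)).
  have [ui_size yi_incr _] := u_spec i; have [uj_size yj_incr _] := u_spec j.
  rewrite tree_dist_fork ?y_size ?eqn_add2l // ui_size uj_size.
  by apply: le_trans; rewrite addnn -muln2 natrM natrX mulrCA [_ * 2]mulrC.
- by move=> i; have [] := u_spec i.
have [un_size yn_incr _] := u_spec n.
exists (t ++ c n :: u n); have -> : s ++ m :: t ++ c n :: u n = y n.
  by rewrite /y /z -catA.
split=> //; first by rewrite size_cat /= un_size -addSn t_size expnS; lia.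
move: gain; congr (_ <= _ `^ p * _); first by rewrite mulrCA exprS.
by rewrite -addn1 natrD mulrDl opprD addrA.
Qed.

Lemma distortion_log2 : (0 < h)%N -> 0 <= K ->
  CU^-1 * log2 h%:R `^ (1 / p) <= K.
Proof.
move=> h_gt0 K_ge0.
pose k := trunc_log 2 h.
have /andP[le_kh lt_hk] := @trunc_log_bounds 2 h isT h_gt0.
(* The root and its child labelled 0 serve as starting point. *)
have [t [t_size t_incr ub]] := short_descendant k [::] 0%N isT le_kh.
have /andP[lb _] := f_lip (vertex h [::]) (vertex h (0%N :: t)).
have {}lb : l * 2 ^+ k <= mdist (F [::]) (F (0%N :: t)).
  move: lb; rewrite -[0%N :: t]cat0s tree_dist_descendant //= ?t_size //.
  by rewrite natrX.
have scale_gt0 : 0 < l * 2 ^+ k by rewrite mulr_gt0 ?exprn_gt0.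
have {lb ub} Kp_ge : 1 <= K `^ p - k%:R / CU `^ p.
  rewrite -(ler_pM2l (powR_gt0 p scale_gt0)) mulr1; apply: le_trans ub.
  by apply: ge0_ler_powR; rewrite ?nnegrE ?mdist_ge0 ?(ltW p_gt0) ?(ltW scale_gt0).
have CUp_ge1 : 1 <= CU `^ p by apply: le_trans hCU _; exact: le1r_powR.
have CUp_gt0 : 0 < CU `^ p by lra.
have ln2_gt0 : 0 < ln 2 :> R by rewrite ln_gt0 ?ltr1n.
have log_ge0 : 0 <= log2 (h%:R : R).
  by rewrite divr_ge0 ?(ltW ln2_gt0) // ln_ge0 ?ler1n.
have log_le : log2 (h%:R : R) <= k%:R + 1.
  rewrite ler_pdivrMr // -[1]/(1%:R) -natrD addn1 mulr_natl -lnXn //.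
  rewrite ler_ln ?posrE ?ltr0n ?exprn_gt0 //.
  by rewrite -natrX ler_nat ltnW.
have log_le_Kp : log2 h%:R <= CU `^ p * K `^ p.
  apply: le_trans log_le _; rewrite mulrC -ler_pdivrMr // mulrDl.
  have : 1 / CU `^ p <= 1 by rewrite ler_pdivrMr // mul1r.
  lra.
rewrite ler_pdivrMl //.
have -> : CU * K = ((CU * K) `^ p) `^ (1 / p).
  by rewrite -powRrM div1r mulfV ?gt_eqF // powRr1 // mulr_ge0 ?(ltW CU_gt0).
apply: ge0_ler_powR; rewrite ?nnegrE ?powR_ge0 //.
  by rewrite divr_ge0 ?(ltW p_gt0).
by rewrite powRM // (ltW CU_gt0).
Qed.

End UmbelSpace.

Theorem theorem2p6 (R : realType) (p CU : R) (hp : 1 <= p) (hCU : 1 <= CU) :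
  exists C : R, 0 < C /\
    forall X : metricType R, infrasup_umbel p CU X ->
    forall h : nat, (0 < h)%N ->
    forall f : tree h -> X,
      let dT := fun A B : tree h => (tree_dist A B)%:R : R in
      bi_lipschitz dT mdist f ->
      C * log2 h%:R `^ (1 / p) <= distortion dT mdist f.
Proof.
exists CU^-1; split=> [|X umbel h h_gt0 f dT f_bilip]; first by rewrite invr_gt0; lra.
apply: lb_le_inf => // K [K_ge1 [l l_gt0 f_lip]].
apply: (distortion_log2 _ _ _ _ hp hCU umbel _ _ _ _ l_gt0 f_lip h_gt0).
exact: le_trans K_ge1.
Qed.
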